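(* Let $a<b$ be real numbers and let $f:[a,b]\to\mathbb{R}$ be continuous on $[a,b]$ and differentiable on $(a,b)$. Then: (i) If $f'(x)\ge -2$ for each $x\in(a,b)$, $f(a)>0$, $f(b)<0$, and $f$ has a unique root $c$ in $(a,b)$, then for each $x_0\in[a,b]$ the sequence defined by $$x_{n+1}=x_n+\frac{f(x_n)}{2}\quad\text{for each } n\ge 0$$ converges to $c$. (ii) If $f'(x)\le 2$ for each $x\in(a,b)$, $f(a)<0$, $f(b)>0$, and $f$ has a unique root $c$ in $(a,b)$, then for each $x_0\in[a,b]$ the sequence defined by $$x_{n+1}=x_n-\frac{f(x_n)}{2}\quad\text{for each } n\ge 0$$ converges to $c$.
   Context: A root of $f$ is a point $x$ of its domain with $f(x)=0$. The assertion that a recursively defined sequence converges includes that it is well defined, i.e. every $x_n$ lies in the domain $[a,b]$ of $f$. *)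

(* Defs.v *)
From mathcomp Require Import all_boot all_order all_algebra.
From mathcomp Require Import all_classical all_reals all_analysis.

Set Implicit Arguments.
Unset Strict Implicit.
Unset Printing Implicit Defensive.

Import Order.TTheory GRing.Theory Num.Theory.
Import numFieldNormedType.Exports.

Local Open Scope classical_set_scope.
Local Open Scope ring_scope.

(* [f : R -> R] stands for an arbitrary extension to [R] of a function whose
   domain is [D]; only points of [D] count as roots. *)
Definition is_root (R : realType) (D : set R) (f : R -> R) (x : R) : Prop :=
  D x /\ f x = 0.

Definition unique_root_in (R : realType) (D : set R) (f : R -> R)
    (I : set R) (c : R) : Prop :=
  [/\ is_root D f c, I c & forall y, is_root D f y -> I y -> y = c].

(* The recursion [x_(n+1) = g x_n] only makes sense for a [g] with domain [D]
   as long as the terms stay in [D]; since [g] is represented by a total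
   function, this requirement is part of convergence here. *)
Definition rec_converges (R : realType) (D : set R) (g : R -> R) (x0 c : R)
    : Prop :=
  forall x : nat -> R, x 0%N = x0 -> (forall n, x n.+1 = g (x n)) ->
  (forall n, D (x n)) /\ x @ \oo --> c.

(* Main.v *)
(** Both recursions iterate a map [g] fixing [c]; the bound on the derivative
    of [f] says exactly that [g] is nondecreasing.  Hence the iterates of [g]
    never cross [c].  By the intermediate value theorem and the uniqueness of
    the root, [g] moves the points of either side towards [c], so the sequence
    is monotone, and its limit, being a fixed point of [g], is [c]. *)
Require Import Defs.
From mathcomp Require Import all_boot all_order all_algebra.
From mathcomp Require Import all_classical all_reals all_analysis.
From mathcomp Require Import lra.

Import Order.TTheory GRing.Theory Num.Theory.
Import numFieldNormedType.Exports.

Local Open Scope classical_set_scope.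
Local Open Scope ring_scope.

(** This serves to pass to the limit in the recursion: since all terms and the limit lie in [A],
    continuity relative to [A] is enough. *)
Lemma within_continuous_cvgn (T U : topologicalType) (A : set T) (g : T -> U)
    (u : nat -> T) (l : T) :
  {within A, continuous g} -> (forall n, A (u n)) -> A l ->
  u @ \oo --> l -> g \o u @ \oo --> g l.
Proof.
move=> /subspace_continuousP gcont uA Al ul.
apply: cvg_comp (gcont _ Al) => P.
by rewrite /within /= => /ul; apply: (@filterS _ \oo) => n /= /(_ (uA n)).
Qed.

Lemma iter_cvg_from_left (R : realType) (a c : R) (g : R -> R) (x : nat -> R) :
  {within `[a, c], continuous g} ->
  {in `[a, c] &, {homo g : y z / y <= z}} ->
  a < g a -> g c = c -> (forall y, y \in `[a, c] -> g y = y -> y = c) ->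
  x 0%N \in `[a, c] -> (forall n, x n.+1 = g (x n)) ->
  (forall n, x n \in `[a, c]) /\ x @ \oo --> c.
Proof.
move=> gcont gmono ga gc uniq x0 xS.
have le_ac : a <= c by move: x0; rewrite in_itv /= => /andP[] /le_trans; apply.
have cac : c \in `[a, c] by rewrite in_itv /= le_ac lexx.
(* If [g y < y], then [g - id] is negative at [y] and positive at [a], so it vanishes at some [z] in
   [[a, y]]. Uniqueness gives [z = c], which forces [y = c] and contradicts [g c = c]. *)
have le_g y : y \in `[a, c] -> y <= g y.
  move=> yac; rewrite leNgt; apply/negP => gy.
  have [ay yc] : a <= y /\ y <= c by apply/andP; rewrite in_itv in yac.
  have hcont : {within `[a, y], continuous (g - id)}.
    apply: within_continuousB; last first.
      by apply: continuous_subspaceT => z; exact: cvg_id.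
    apply: continuous_subspaceW gcont => z /=.
    by rewrite !in_itv /= => /andP[-> /le_trans]; apply.
  have [|z zay /subr0_eq gz] := @IVT _ _ _ _ 0 ay hcont.
    by rewrite ge_min le_max !fctE /= !subr_le0 !subr_ge0 (ltW gy) (ltW ga) orbT.
  have [az zy] : a <= z /\ z <= y by apply/andP; rewrite in_itv in zay.
  have zc : z = c.
    by apply: uniq gz; rewrite in_itv /= az (le_trans zy).
  have yc' : y = c by apply/le_anti; rewrite yc -zc zy.
  by move: gy; rewrite yc' gc ltxx.
(* The lower bound persists because [g] moves points up, the upper one because monotonicity gives
   [g (x n) <= g c = c]. *)
have xac n : x n \in `[a, c].
  elim: n => // n IHn; rewrite xS in_itv /=.
  have := IHn; rewrite in_itv /= => /andP[ax xc].
  by rewrite (le_trans ax (le_g _ IHn)) -[X in _ <= X]gc gmono.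
have xnd : {homo x : n m / (n <= m)%N >-> n <= m}.
  by apply/nondecreasing_seqP => n; rewrite xS le_g.
have : cvgn x.
  apply: nondecreasing_is_cvgn => //; exists c => _ [n _ <-].
  by have := xac n; rewrite in_itv => /andP[].
move=> /cvg_ex[l xl].
have lac : l \in `[a, c].
  by apply: (closed_cvg (fun y => y \in `[a, c])) xl => //;
     [exact: itv_closed | exact: nearW].
(* The sequence [g \o x] tends to [g l] by continuity and to [l] as the shift of [x], so [l] is a
   fixed point. *)
have gxl : g \o x @ \oo --> g l by exact: within_continuous_cvgn gcont xac lac xl.
have gxl' : g \o x @ \oo --> l.
  have -> : g \o x = [sequence x n.+1]_n by apply/funext => n; rewrite /= -xS.
  by rewrite cvg_shiftS.
have gl : g l = l by exact: cvg_unique gxl gxl'.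
by split=> //; rewrite -(uniq l lac gl).
Qed.

(** The reflection [y |-> - y] conjugates [g] to [y |-> - g (- y)], which is again nondecreasing,
    and reduces this to the left-hand case. *)
Lemma iter_cvg_from_right (R : realType) (c b : R) (g : R -> R)
    (x : nat -> R) :
  {within `[c, b], continuous g} ->
  {in `[c, b] &, {homo g : y z / y <= z}} ->
  g b < b -> g c = c -> (forall y, y \in `[c, b] -> g y = y -> y = c) ->
  x 0%N \in `[c, b] -> (forall n, x n.+1 = g (x n)) ->
  (forall n, x n \in `[c, b]) /\ x @ \oo --> c.
Proof.
move=> gcont gmono gb gc uniq x0 xS.
have itvN y : (y \in `[- b, - c]) = (- y \in `[c, b]) by rewrite oppr_itvcc.
have [| | | | | |n|xcb xc] :=
  @iter_cvg_from_left _ (- b) (- c) (fun y => - g (- y)) (fun n => - x n).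
- have gNcont : {within `[- b, - c], continuous g \o -%R}.
    by apply: within_continuous_compN; rewrite !opprK.
  by move=> y; apply: cvgN; exact: gNcont.
- by move=> y z; rewrite !itvN => yI zI yz; rewrite lerN2 gmono ?lerN2.
- by rewrite opprK ltrN2.
- by rewrite opprK gc.
- move=> y; rewrite itvN => yI /(congr1 -%R); rewrite opprK => /uniq <- //.
  by rewrite opprK.
- by rewrite itvN opprK.
- by rewrite opprK xS.
- by split=> [n|]; [rewrite -[x n]opprK -itvN | apply/cvgNP].
Qed.

(** The iteration stays on the side of [c] where it starts: the condition at [a] drives the left
    side, the one at [b] the right side. *)
Lemma rec_converges_nondecreasing (R : realType) (a b c : R) (g : R -> R) :
  {within `[a, b], continuous g} ->
  {in `[a, b] &, {homo g : y z / y <= z}} ->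
  a < g a -> g b < b -> c \in `[a, b] -> g c = c ->
  (forall y, y \in `[a, b] -> g y = y -> y = c) ->
  forall x0, x0 \in `[a, b] -> rec_converges `[a, b] g x0 c.
Proof.
move=> gcont gmono ga gb; rewrite in_itv /= => /andP[ac cb] gc uniq x0.
rewrite in_itv /= => /andP[ax0 x0b] x xx0 xS.
have sub_l : {subset `[a, c] <= `[a, b]}.
  by move=> y; rewrite !in_itv /= => /andP[-> /le_trans ->].
have sub_r : {subset `[c, b] <= `[a, b]}.
  by move=> y; rewrite !in_itv /= => /andP[/(le_trans ac) -> ->].
have [x0c|/ltW cx0] := leP x0 c.
- have [| | | |xac xc] := @iter_cvg_from_left _ a c g x _ _ ga gc _ _ xS.
  + exact: continuous_subspaceW gcont.
  + by apply: sub_in2 gmono.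
  + by move=> y /sub_l; exact: uniq.
  + by rewrite xx0 in_itv /= ax0.
  + by split=> // n; exact: sub_l.
- have [| | | |xcb xc] := @iter_cvg_from_right _ c b g x _ _ gb gc _ _ xS.
  + exact: continuous_subspaceW gcont.
  + by apply: sub_in2 gmono.
  + by move=> y /sub_r; exact: uniq.
  + by rewrite xx0 in_itv /= cx0.
  + by split=> // n; exact: sub_r.
Qed.

(** The map [x + f x / 2] has derivative [1 + f' / 2], nonnegative exactly when [f' >= -2]. Its
    fixed points are the roots of [f], and the signs of [f] at the endpoints say that it moves both
    of them inwards. *)
Lemma rec_converges_add_half (R : realType) (a b c : R) (f : R -> R) :
  {within `[a, b], continuous f} ->
  (forall x, x \in `]a, b[ -> derivable f x 1) ->
  (forall x, x \in `]a, b[ -> -2 <= derive1 f x) ->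
  0 < f a -> f b < 0 -> unique_root_in `[a, b] f `]a, b[ c ->
  forall x0, x0 \in `[a, b] ->
  rec_converges `[a, b] (fun x => x + f x / 2) x0 c.
Proof.
move=> fcont fdiff f'ge fa fb [[cI fc] _ uniq].
have gcont : {within `[a, b], continuous (fun x => x + f x / 2)}.
  apply: within_continuousD.
      by apply: continuous_subspaceT => z; exact: cvg_id.
  by move=> y; apply: cvgMl; exact: fcont.
have gdrv x : x \in `]a, b[ ->
    is_derive x 1 (fun x => x + f x / 2) (1 + derive1 f x / 2).
  move=> xI; have fD := derivableP (fdiff x xI).
  rewrite derive1E.
  have -> : (fun x => x + f x / 2) = id + (2^-1 \*: f).
    by apply/funext => y; rewrite !fctE /= mulrC.
  by apply: is_derive_eq; rewrite /GRing.scale /= mulrC.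
apply: rec_converges_nondecreasing => //.
- apply: ger0_derive1_le_cc => // x xI; have gD := gdrv x xI.
    exact: ex_derive.
  by rewrite derive1E derive_val; have := f'ge x xI; lra.
- lra.
- lra.
- by rewrite fc; lra.
- move=> y yI gy; have fy : f y = 0 by lra.
  (* Uniqueness is assumed only on the open interval; the endpoints are excluded as roots by the
     signs of [f a] and [f b]. *)
  apply: uniq => //=; move: yI; rewrite !in_itv /= !le_eqVlt.
  move=> /andP[/predU1P[ay|->] /predU1P[yb|->]] //; exfalso; subst; lra.
Qed.

Theorem theorem2p1 (R : realType) (a b : R) (f : R -> R)
    (ltab : a < b)
    (fcont : {within `[a, b], continuous f})
    (fdiff : forall x, x \in `]a, b[ -> derivable f x 1) :
  (forall c : R,
     (forall x, x \in `]a, b[ -> -2 <= derive1 f x) ->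
     0 < f a -> f b < 0 ->
     unique_root_in `[a, b] f `]a, b[ c ->
     forall x0, x0 \in `[a, b] ->
     rec_converges `[a, b] (fun x => x + f x / 2) x0 c)
  /\
  (forall c : R,
     (forall x, x \in `]a, b[ -> derive1 f x <= 2) ->
     f a < 0 -> 0 < f b ->
     unique_root_in `[a, b] f `]a, b[ c ->
     forall x0, x0 \in `[a, b] ->
     rec_converges `[a, b] (fun x => x - f x / 2) x0 c).
Proof.
split=> c; first exact: rec_converges_add_half.
move=> f'le fa fb [[cI fc] cI' uniq] x0 x0I.
(* Part (ii) is part (i) for [- f], which has the same roots, opposite signs at the endpoints and
   derivative at least [-2]. *)
have -> : (fun x => x - f x / 2) = (fun x => x + (- f) x / 2).
  by apply/funext => x; rewrite mulNr.
apply: rec_converges_add_half => //.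
- by move=> y; apply: cvgN; exact: fcont.
- by move=> x xI; apply: derivableN; exact: fdiff.
- by move=> x xI; rewrite derive1N ?lerN2 ?f'le //; exact: fdiff.
- by rewrite oppr_gt0.
- by rewrite oppr_lt0.
- split=> //; first by split=> //; rewrite fctE fc oppr0.
  move=> y [yI] /eqP; rewrite oppr_eq0 => /eqP fy; exact: uniq.
Qed.
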